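(* Let $G$ be a simple connected graph satisfying property (R) and let $m\ge 3$ be an integer. Then $F_2^m(G)$ satisfies property (R) if and only if $G$ is bipartite.
   Context: A graph is nonsingular if its adjacency matrix is nonsingular. A nonsingular graph $G$ has property (R) if for each eigenvalue $\lambda$ of $A(G)$, $1/\lambda$ is also an eigenvalue of $A(G)$. The $m$-shadow graph $D_m(G)$ consists of $m$ copies $G_1,\dots,G_m$ of $G$, where each vertex $u$ in $G_i$ is joined to the neighbors of the corresponding vertex in $G_j$, $1\le i,j\le m$; its adjacency matrix is $J_m\otimes A(G)$ with $J_m$ the $m\times m$ all-ones matrix. $F_2^m(G)$ ($m\ge 3$) is obtained from $D_m(G)$ by deleting the edges inside $G_i$ for all $2\le i\le m$. Thus its adjacency matrix is $H\otimes A(G)$, where $H$ is the $m\times m$ 0-1 matrix with zeros exactly at positions $(i,i)$, $2\le i\le m$. *)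

(* Defs.v *)
From HB Require Import structures.
From mathcomp Require Import all_boot all_order all_algebra.
Set Implicit Arguments.
Unset Strict Implicit.
Unset Printing Implicit Defensive.
Import Order.TTheory GRing.Theory Num.Theory.
Local Open Scope ring_scope.

(* A finite graph is an adjacency relation [e] on a finite vertex type. *)

Definition simple_graph (T : finType) (e : rel T) : Prop :=
  symmetric e /\ irreflexive e.

(* The graph without vertices is not considered connected. *)
Definition connected_graph (T : finType) (e : rel T) : Prop :=
  (0 < #|T|)%N /\ forall u v : T, connect e u v.

Definition bipartite (T : finType) (e : rel T) : Prop :=
  exists A : {set T}, forall u v : T, e u v -> (u \in A) != (v \in A).

(* Rows and columns follow the enumeration of [T]. *)
Definition adjmx (F : fieldType) (T : finType) (e : rel T) : 'M[F]_#|T| :=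
  \matrix_(i, j) (e (enum_val i) (enum_val j))%:R.

Definition nonsingular (F : fieldType) (T : finType) (e : rel T) : Prop :=
  adjmx F e \in unitmx.

(* Eigenvalues are compared as a set, without multiplicities (property (R),
   as opposed to the strong reciprocal property). *)
Definition propertyR (F : fieldType) (T : finType) (e : rel T) : Prop :=
  nonsingular F e /\
  forall a : F, eigenvalue (adjmx F e) a -> eigenvalue (adjmx F e) a^-1.

(* The vertex [(i, u)] is the copy of [u] in the i-th copy of the graph; copies
   are numbered from 0. *)
Definition shadow (m : nat) (T : finType) (e : rel T) : rel ('I_m * T) :=
  fun x y => e x.2 y.2.

(* All copies but the first (index 0) lose their internal edges. *)
Definition F2 (m : nat) (T : finType) (e : rel T) : rel ('I_m * T) :=
  fun x y => shadow e x y && ~~ ((x.1 == y.1) && (0 < x.1)%N).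

Lemma F2_simple (m : nat) (T : finType) (e : rel T) :
  simple_graph e -> simple_graph (@F2 m T e).
Proof.
move=> [sym_e irr_e]; split=> [x y | x]; rewrite /F2 /shadow ?irr_e //.
by rewrite sym_e [y.1 == _]eq_sym; case: eqP => // ->.
Qed.

(* The adjacency matrix of [F2] is the Kronecker product of [H] and [adjmx e],
   up to the enumeration of ['I_m * T]. *)
Lemma adjmx_F2 (F : fieldType) (m : nat) (T : finType) (e : rel T)
    (H := \matrix_(i < m, j < m) ((i != j) || (i == 0 :> nat))%:R : 'M[F]_m)
    (i j : 'I_m) (u v : T) :
  adjmx F (@F2 m T e) (enum_rank (i, u)) (enum_rank (j, v)) =
  H i j * adjmx F e (enum_rank u) (enum_rank v).
Proof.
by rewrite !mxE !enum_rankK /F2 /shadow /= negb_and lt0n negbK andbC -mulnb natrM.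
Qed.

(* Main.v *)
Require Import Defs.
From mathcomp Require Import all_boot all_order all_algebra.
From mathcomp Require Import ring.
Set Implicit Arguments.
Unset Strict Implicit.
Unset Printing Implicit Defensive.
Import Order.TTheory GRing.Theory Num.Theory.
Local Open Scope ring_scope.

(** Write [n.+1] for the number of copies. The adjacency matrix of [F2] is the
    Kronecker product of [adjmx e] with [H], the all-ones matrix with its
    diagonal erased except for the corner. The eigenvalues of [H] are [-1],
    from vectors supported on the copies other than the first with entries
    summing to zero, and the two roots [theta > 1] and [- theta^-1] of
    [X^2 - n X - 1], from vectors constant on those copies. Hence the spectrum
    of [F2] consists of [- b], [theta * b] and [- b / theta], for [b] in the
    spectrum of [e] (lemma [eigenvalue_F2]).

    If [e] is bipartite, its spectrum is stable under [b |-> - b]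
    ([bipartite_eigenvalueN]), as well as under inversion by property (R), and
    then the three families above are exchanged by inversion: the first with
    itself, the second with the third.

    Conversely, take an eigenvalue [mu] of [e] of maximal modulus. By property
    (R) for [F2], the number [(theta * mu)^-1] belongs to one of the three
    families. In the first two, property (R) for [e] would turn it into an
    eigenvalue [- theta * mu] or [theta ^+ 2 * mu] of [e], of modulus larger
    than that of [mu]. The third makes [- mu^-1], hence [- mu], an eigenvalue
    of [e].

    It remains to see that a connected graph with both [mu] and [- mu] as
    eigenvalues of maximal modulus is bipartite ([perron_bipartite]). With
    [rho = `|mu|] and [x] an eigenvector for [- rho], the triangle inequality
    shows that the Rayleigh quotient of [`|x|] is at least [rho], so that [`|x|]
    is an eigenvector for [rho] ([rayleigh_eigenvector]), nowhere zero by
    connectedness ([eigenfun_gt0]). The triangle inequality is then an equality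
    at every vertex, which forces the phase [x v / `|x v|] to change sign along
    each edge, and the sign gives the two classes. *)

(** * Hermitian matrices *)

Section Hermitian.
Local Open Scope sesquilinear_scope.
Variables (C : numClosedFieldType) (n : nat).
Implicit Types (A : 'M[C]_n) (x : 'rV[C]_n).

Lemma normal_diagonalize A : A \is normalmx ->
  spectralmx A *m A = diag_mx (spectral_diag A) *m spectralmx A.
Proof.
move=> /orthomx_spectralP {2}->.
by rewrite !mulmxA mulmxV ?spectral_unit // mul1mx.
Qed.

Lemma eigenvalue_spectral_diag A j : A \is normalmx ->
  eigenvalue A (spectral_diag A 0 j).
Proof.
move=> Anormal; apply/eigenvalueP; exists (row j (spectralmx A)).
  by rewrite -row_mul normal_diagonalize // row_mul row_diag_mx -scalemxAl -rowE.
apply: contraTneq (spectral_unit A) => row_j0.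
rewrite -row_free_unit; apply/negP => /row_free_inj inj_P.
have /inj_P : delta_mx 0 j *m spectralmx A = (0 : 'rV_n) *m spectralmx A.
  by rewrite -rowE row_j0 mul0mx.
by move/rowP/(_ j); rewrite !mxE !eqxx => /eqP; rewrite oner_eq0.
Qed.

Lemma eigenvalue_in_spectral_diag A a : A \is normalmx -> eigenvalue A a ->
  exists j, a = spectral_diag A 0 j.
Proof.
move=> /orthomx_spectralP A_eq /eigenvalueP [x xA x_neq0].
set P := spectralmx A in A_eq *; set d := spectral_diag A in A_eq *.
have Punit : P \in unitmx := spectral_unit A.
pose z := x *m invmx P.
have zD : z *m diag_mx d = a *: z.
  by rewrite /z scalemxAl -xA A_eq !mulmxA mulmxK.
have [j zj_neq0] : exists j, z 0 j != 0.
  apply/existsP; rewrite -negb_forall; apply: contra x_neq0 => /forallP z0.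
  rewrite -(mulmxKV Punit x) -/z (_ : z = 0) ?mul0mx //.
  by apply/rowP=> j; rewrite [RHS]mxE; apply/eqP/z0.
exists j; apply: (mulIf zj_neq0).
by move/rowP/(_ j): zD; rewrite mul_mx_diag !mxE => <-; rewrite mulrC.
Qed.

Lemma eigenvalue_hermitian_real A a : A \is hermsymmx -> eigenvalue A a ->
  a \is Num.real.
Proof.
move=> Aherm /(eigenvalue_in_spectral_diag (hermitian_normalmx Aherm)) [j ->].
exact: (mxOverP (hermitian_spectral_diag_real Aherm)).
Qed.

Lemma exists_max_eigenvalue A : (0 < n)%N -> A \is hermsymmx ->
  exists2 mu, eigenvalue A mu & forall b, eigenvalue A b -> `|b| <= `|mu|.
Proof.
move=> n_gt0 /hermitian_normalmx Anormal.
pose F j := `|spectral_diag A 0 j|.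
case: (@real_arg_maxP _ _ (Ordinal n_gt0) xpredT F) => // [j _|j _ max_j].
  exact: normr_real.
exists (spectral_diag A 0 j); first exact: eigenvalue_spectral_diag.
by move=> b /(eigenvalue_in_spectral_diag Anormal) [k ->]; apply: max_j.
Qed.

(** In an orthonormal eigenbasis the hypothesis says that the sum of the
    nonnegative terms [(rho - d j) * `|z j| ^+ 2] is at most zero; so each of
    them vanishes, and [x] only involves eigenvectors for [rho]. *)
Lemma rayleigh_eigenvector A rho x : A \is hermsymmx ->
  (forall a, eigenvalue A a -> a <= rho) ->
  rho * (x *m x ^t*) 0 0 <= (x *m A *m x ^t*) 0 0 -> x *m A = rho *: x.
Proof.
move=> Aherm le_rho; have Anormal := hermitian_normalmx Aherm.
have /orthomx_spectralP A_eq := Anormal.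
have Pu := spectral_unitarymx A.
set P := spectralmx A in A_eq Pu *; set d := spectral_diag A in A_eq *.
have [z x_eq] : exists z, x = z *m P by exists (x *m P ^t*); rewrite mulmxKtV.
have xA_eq : x *m A = z *m diag_mx d *m P.
  by rewrite A_eq invmx_unitary // {1}x_eq !mulmxA mulmxtVK.
have dot_eq (u v : 'rV_n) : (u *m P) *m (v *m P) ^t* = u *m v ^t*.
  by rewrite trmx_mul map_mxM !mulmxA mulmxtVK.
rewrite xA_eq [in X in X -> _]x_eq !dot_eq -subr_ge0 => q_ge0.
have q_eq : \sum_j (rho - d 0 j) * `|z 0 j| ^+ 2 = 0.
  apply/eqP; rewrite eq_le sumr_ge0 ?andbT => [|j _]; last first.
    by rewrite mulr_ge0 ?exprn_ge0 // subr_ge0 le_rho ?eigenvalue_spectral_diag.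
  rewrite -oppr_ge0; apply: le_trans q_ge0 _; rewrite le_eqVlt; apply/orP; left.
  rewrite !mxE mulr_sumr -!sumrB -sumrN; apply/eqP/eq_bigr=> j _.
  by rewrite mul_mx_diag !mxE normCK; ring.
have zD : z *m diag_mx d = rho *: z.
  apply/rowP=> j; rewrite mul_mx_diag !mxE.
  have /eqP := q_eq; rewrite psumr_eq0 => [/allP /(_ j)|k _]; last first.
    by rewrite mulr_ge0 ?exprn_ge0 // subr_ge0 le_rho ?eigenvalue_spectral_diag.
  rewrite mem_index_enum => /(_ isT) /=; rewrite mulf_eq0 expf_eq0 normr_eq0 /=.
  by case/orP=> [|/eqP->]; rewrite ?mul0r ?mulr0 // subr_eq0 => /eqP->; rewrite mulrC.
by rewrite zD -scalemxAl -x_eq.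
Qed.

End Hermitian.

(** * Eigenfunctions on the vertices *)

Section Eigenfunctions.
Variables (F : fieldType) (T : finType) (e : rel T).

(** Eigenvectors are handled as functions on the vertices, free of the
    enumeration that indexes [adjmx]. *)
Definition eigenfun (a : F) (f : T -> F) : Prop :=
  forall v, \sum_u (e u v)%:R * f u = a * f v.

Definition rowfun (f : T -> F) : 'rV[F]_#|T| := \row_i f (enum_val i).

Lemma rowfun_adjmxE f i :
  (rowfun f *m adjmx F e) 0 i = \sum_u (e u (enum_val i))%:R * f u.
Proof.
rewrite mxE (reindex _ (onW_bij _ (@enum_val_bij T))) /=.
by apply: eq_bigr => j _; rewrite !mxE mulrC.
Qed.

Lemma eigenfunP a f : eigenfun a f <-> rowfun f *m adjmx F e = a *: rowfun f.
Proof.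
split=> [ef | /rowP ef v]; first by apply/rowP=> i; rewrite rowfun_adjmxE ef !mxE.
by move: (ef (enum_rank v)); rewrite rowfun_adjmxE !mxE enum_rankK.
Qed.

Lemma eigenvalue_adjmxP a :
  eigenvalue (adjmx F e) a <-> exists f, eigenfun a f /\ exists v, f v != 0.
Proof.
split=> [/eigenvalueP [x xA x_neq0] | [f [/eigenfunP ef [v fv]]]]; last first.
  apply/eigenvalueP; exists (rowfun f) => //; apply: contraNneq fv => /rowP.
  by move/(_ (enum_rank v)); rewrite !mxE enum_rankK => ->.
pose f v := x 0 (enum_rank v).
have fE : rowfun f = x by apply/rowP=> i; rewrite mxE /f enum_valK.
exists f; split; first by apply/eigenfunP; rewrite fE.
apply/existsP; rewrite -negb_forall; apply: contra x_neq0 => /forallP f0.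
by rewrite -fE; apply/eqP/rowP=> i; rewrite !mxE; apply/eqP/f0.
Qed.

Lemma nonsingular_eigenvalue0 : nonsingular F e <-> ~~ eigenvalue (adjmx F e) 0.
Proof.
rewrite /nonsingular -row_free_unit -kermx_eq0.
by rewrite /eigenvalue /eigenspace raddf0 subr0 negbK.
Qed.

End Eigenfunctions.

Lemma adjmx_hermsym (C : numClosedFieldType) (T : finType) (e : rel T) :
  symmetric e -> adjmx C e \is hermsymmx.
Proof.
move=> sym_e; apply: realsym_hermsym.
  by apply/is_hermitianmxP; rewrite expr0 scale1r; apply/matrixP=> i j; rewrite !mxE sym_e.
by apply/mxOverP=> i j; rewrite mxE realn.
Qed.

(** * Bipartiteness and the spectrum *)

Section Bipartite.
Variables (C : numClosedFieldType) (T : finType) (e : rel T).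

(** Negating an eigenvector on one of the two classes negates the sum over the
    neighbours of a vertex relatively to the value at that vertex. *)
Lemma bipartite_eigenvalueN (a : C) : bipartite e ->
  eigenvalue (adjmx C e) a -> eigenvalue (adjmx C e) (- a).
Proof.
move=> [A eA] /eigenvalue_adjmxP [f [ef [v fv]]]; apply/eigenvalue_adjmxP.
exists (fun u => (-1) ^+ (u \in A) * f u); split=> [w|]; last first.
  by exists v; rewrite mulf_neq0 // signr_eq0.
rewrite mulrCA mulNr -ef -sumrN mulr_sumr; apply: eq_bigr => u _.
have [/eA|_] := boolP (e u w); last by rewrite !mul0r oppr0 mulr0.
by case: (u \in A); case: (w \in A) => // _; rewrite /= ?expr0 ?expr1; ring.
Qed.

(** By connectedness [s] takes only the values [s v0] and [- s v0], which differ
    since the characteristic is zero; they are the two classes. *)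
Lemma bipartite_of_sign (s : T -> C) : connected_graph e -> (forall v, s v != 0) ->
  (forall u v, e u v -> s u = - s v) -> bipartite e.
Proof.
move=> [/card_gt0P [v0 _] conn_e] s_neq0 s_edge.
have s_pm v : (s v == s v0) || (s v == - s v0).
  pose B := [pred v | (s v == s v0) || (s v == - s v0)].
  suff closedB : closed e B by rewrite -[_ || _]/(v \in B)
    -(closed_connect closedB (conn_e v0 v)) inE eqxx.
  by move=> u w /s_edge su; rewrite !inE su eqr_opp eqr_oppLR orbC.
exists [set v | s v == s v0] => u v /s_edge su; rewrite !inE.
have opp_neq : (- s v0 == s v0) = false.
  by rewrite eq_sym -subr_eq0 opprK -mulr2n mulrn_eq0 (negPf (s_neq0 _)).
rewrite su; case/orP: (s_pm v) => /eqP ->; rewrite ?opprK eqxx ?opp_neq //.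
Qed.

(** A zero of [y] is a sum of nonnegative values at the neighbours, which are
    then zeros too; so the zeros propagate to the whole connected graph. *)
Lemma eigenfun_gt0 (rho : C) (y : T -> C) : connected_graph e -> symmetric e ->
  eigenfun e rho y -> (forall v, 0 <= y v) -> (exists v, y v != 0) ->
  forall v, 0 < y v.
Proof.
move=> [_ conn_e] sym_e ey y_ge0 [w yw] v; rewrite lt_neqAle y_ge0 andbT eq_sym.
suff closedB : closed e [pred v | y v != 0].
  by rewrite -[_ != 0]/(v \in [pred v | y v != 0]) -(closed_connect closedB (conn_e w v)).
suff zero_nb u x : e u x -> y x = 0 -> y u = 0.
  move=> u x eux; rewrite !inE; congr (~~ _).
  apply/eqP/eqP; last exact: zero_nb.
  by apply: zero_nb; rewrite sym_e.
move=> eux yx; have /eqP := ey x; rewrite yx mulr0 psumr_eq0 => [|z _]; last first.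
  by rewrite mulr_ge0 ?ler0n.
by move/allP/(_ u); rewrite mem_index_enum eux mul1r => /(_ isT) /eqP.
Qed.

(** The part of the Perron-Frobenius theorem saying that the spectral radius and
    its opposite are both eigenvalues only for bipartite graphs: the modulus of
    an eigenvector for [- rho] is an eigenvector for [rho]. *)
Lemma perron_bipartite (mu : C) : symmetric e -> connected_graph e ->
  mu != 0 -> eigenvalue (adjmx C e) mu -> eigenvalue (adjmx C e) (- mu) ->
  (forall b, eigenvalue (adjmx C e) b -> `|b| <= `|mu|) -> bipartite e.
Proof.
move=> sym_e conn_e mu_neq0 eig_mu eig_Nmu mu_max.
have Aherm := adjmx_hermsym C sym_e.
set rho : C := `|mu| in mu_max.
have rho_gt0 : 0 < rho by rewrite normr_gt0.
have /eigenvalue_adjmxP [x [ex [w xw]]] : eigenvalue (adjmx C e) (- rho).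
  rewrite /rho real_normrEsign; last exact: eigenvalue_hermitian_real eig_mu.
  by case: (mu < 0); rewrite ?expr0 ?expr1 ?mulN1r ?mul1r ?opprK.
pose y v : C := `|x v|.
have norm_sum v : `|\sum_u (e u v)%:R * x u| = rho * y v.
  by rewrite ex normrM normrN (ger0_norm (ltW rho_gt0)).
have norm_term v u : `|(e u v)%:R * x u| = (e u v)%:R * y u.
  by rewrite normrM normr_nat.
have ey : eigenfun e rho y.
  apply/eigenfunP/rayleigh_eigenvector => // [a eig_a|].
    apply: le_trans (mu_max _ eig_a); apply: real_ler_norm.
    exact: eigenvalue_hermitian_real eig_a.
  rewrite [X in _ <= X]mxE [X in _ * X <= _]mxE mulr_sumr; apply: ler_sum => j _.
  rewrite !mxE mulrA ler_wpM2r ?conjC_ge0 ?normr_ge0 //.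
  have := rowfun_adjmxE e y j; rewrite mxE => ->.
  rewrite -norm_sum; apply: le_trans (ler_norm_sum _ _ _) _.
  by rewrite (eq_bigr _ (fun u _ => norm_term _ u)).
have y_gt0 : forall v, 0 < y v.
  apply: (eigenfun_gt0 conn_e sym_e ey) => [v|]; first exact: normr_ge0.
  by exists w; rewrite /y normr_eq0.
have y_neq0 v : y v != 0 by rewrite gt_eqF.
apply: (bipartite_of_sign (s := fun v => x v / y v)) => // [v|u v euv].
  by rewrite mulf_neq0 ?invr_eq0 // -normr_eq0; apply: y_neq0.
(* The sum of [x] over the neighbours of [v] attains its triangle bound, so [x]
   has the same phase [t] at all of them, and [- t] at [v]. *)
have [|t _ xt] := @normC_sum_eq C T xpredT (fun u => (e u v)%:R * x u).
  by rewrite norm_sum -ey; apply: eq_bigr => z _; rewrite norm_term.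
have xu : x u = y u * t.
  by have := xt u isT; rewrite norm_term euv !mul1r.
have xv : x v = - (y v * t).
  apply: (mulfI (x := - rho)); first by rewrite oppr_eq0 gt_eqF.
  rewrite -ex mulrNN mulrA -ey mulr_suml; apply: eq_bigr => z _.
  by rewrite xt // norm_term.
by rewrite xu xv -mulNr opprK !(mulrAC _ t) !divff // mul1r.
Qed.

End Bipartite.

(** * The spectrum of the shadow graph *)

Section Shadow.
Variables (F : fieldType) (T : finType) (e : rel T).

(** The entries of the Kronecker factor [H] of the adjacency matrix of [F2]. *)
Definition Hcoef {m} (i j : 'I_m) : F := ((i != j) || (i == 0 :> nat))%:R.

Lemma F2E m (x y : 'I_m * T) :
  (@F2 m T e x y)%:R = Hcoef x.1 y.1 * (e x.2 y.2)%:R :> F.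
Proof. by rewrite /F2 /shadow /Hcoef negb_and lt0n negbK andbC -mulnb natrM. Qed.

Lemma sum_F2 m (g : 'I_m * T -> F) y :
  \sum_x (@F2 m T e x y)%:R * g x =
  \sum_u (e u y.2)%:R * \sum_i Hcoef i y.1 * g (i, u).
Proof.
rewrite (eq_bigr _ (fun u _ => mulr_sumr _ _ _ _)) exchange_big pair_big /=.
by apply: eq_bigr => -[i u] _; rewrite F2E /=; ring.
Qed.

(** [H] is the all-ones matrix minus a diagonal one. *)
Lemma sum_Hcoef m (h : 'I_m -> F) (j : 'I_m) :
  \sum_i Hcoef i j * h i = \sum_i h i - (0 < j)%N%:R * h j.
Proof.
rewrite (bigD1 j) // [\sum_i h i](bigD1 j) //= [X in _ + X](eq_bigr h) => [|i ij].
  by rewrite /Hcoef eqxx /= lt0n; case: (_ == _); rewrite /=; ring.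
by rewrite /Hcoef ij mul1r.
Qed.

Definition Heigen m (k : F) (h : 'I_m -> F) : Prop :=
  forall j, \sum_i Hcoef i j * h i = k * h j.

Lemma HcoefC m (i j : 'I_m) : Hcoef i j = Hcoef j i.
Proof. by rewrite /Hcoef eq_sym; case: eqP => // ->. Qed.

Lemma eigenfun_F2_tensor m k (h : 'I_m -> F) a f : Heigen k h -> eigenfun e a f ->
  eigenfun (@F2 m T e) (k * a) (fun x => h x.1 * f x.2).
Proof.
move=> Hh ef y; rewrite sum_F2 /= mulrACA -Hh -ef mulr_sumr.
apply: eq_bigr => u _; rewrite mulrCA; congr (_ * _).
by rewrite mulr_suml; apply: eq_bigr => i _; rewrite mulrA.
Qed.

(** Since [H] is symmetric, pairing the copies of an eigenvector of [F2] with an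
    eigenvector [h] of [H] commutes with the adjacency operators up to [k]. This
    gives an eigenvector of [e], unless it vanishes. *)
Lemma eigenfun_F2_contract m k (h : 'I_m -> F) a g : k != 0 -> Heigen k h ->
  eigenfun (@F2 m T e) a g ->
  eigenfun e (a / k) (fun u => \sum_i h i * g (i, u)).
Proof.
move=> k_neq0 Hh eg v; apply: (mulfI k_neq0); rewrite mulrA mulrCA divff // mulr1.
transitivity (\sum_j h j * \sum_u (e u v)%:R * \sum_i Hcoef i j * g (i, u)).
  under [RHS]eq_bigr do rewrite mulr_sumr.
  rewrite [RHS]exchange_big mulr_sumr /=; apply: eq_bigr => u _.
  under [RHS]eq_bigr do rewrite mulrCA mulr_sumr.
  rewrite -mulr_sumr mulrCA exchange_big; congr (_ * _).
  rewrite mulr_sumr; apply: eq_bigr => i _ /=; rewrite mulrA -Hh mulr_suml.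
  by apply: eq_bigr => j _; rewrite HcoefC; ring.
rewrite mulr_sumr; apply: eq_bigr => j _; rewrite mulrCA -[in RHS]eg sum_F2.
by [].
Qed.

(** On vectors constant on the copies other than the first, [H] acts by the
    two by two matrix with rows [1, n] and [1, n - 1], whose characteristic
    polynomial is [X^2 - n X - 1]. *)
Lemma Heigen_quotient n k : k != 0 -> k ^+ 2 - n%:R * k - 1 = 0 ->
  Heigen k (fun i : 'I_n.+1 => if (0 < i)%N then 1 else 1 + k^-1).
Proof.
move=> k_neq0 k_root j; rewrite sum_Hcoef big_ord_recl /= sumr_const card_ord.
have k_eq : k = n%:R + k^-1.
  by apply: (mulfI k_neq0); rewrite mulrDr divff //; apply/eqP; rewrite -subr_eq0;
    apply/eqP; rewrite -[RHS]k_root; ring.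
case: (0 < j)%N; rewrite /= ?mul0r ?mul1r ?subr0 ?mulr1.
  by rewrite [RHS]k_eq; ring.
by rewrite mulrDr mulr1 divff // [X in _ = X + _]k_eq; ring.
Qed.

Lemma Heigen_difference m (i1 i2 : 'I_m) : (0 < i1)%N -> (0 < i2)%N ->
  Heigen (-1) (fun i : 'I_m => (i == i1)%:R - (i == i2)%:R).
Proof.
move=> i1_gt0 i2_gt0 j; rewrite sum_Hcoef sumrB.
have sum_delta (i0 : 'I_m) : \sum_i (i == i0)%:R = 1 :> F.
  by rewrite (bigD1 i0) //= eqxx big1 ?addr0 // => i /negPf ->.
rewrite !sum_delta subrr add0r mulN1r; congr (- _).
have [|] := ltnP 0 j; first by rewrite mul1r.
by rewrite leqn0 => /eqP j0; rewrite -!val_eqE /= j0 !ltn_eqF // subrr mulr0.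
Qed.

(** Eigenvectors of [e] are lifted to [F2] by tensoring with the eigenvectors of
    [H]. Conversely, the eigenvectors of [H] span the whole space, so some
    contraction of a nonzero eigenvector of [F2] is nonzero. *)
Lemma eigenvalue_F2 n (theta : F) a : (1 < n)%N -> n%:R != 0 :> F ->
  theta != 0 -> theta ^+ 2 - n%:R * theta - 1 = 0 -> theta ^+ 2 + 1 != 0 ->
  eigenvalue (adjmx F (@F2 n.+1 T e)) a <->
  [\/ eigenvalue (adjmx F e) (- a), eigenvalue (adjmx F e) (a / theta) |
      eigenvalue (adjmx F e) (- (theta * a))].
Proof.
move=> n_gt1 n_neq0 th_neq0 th_root th2_neq.
have thN_neq0 : - theta^-1 != 0 by rewrite oppr_eq0 invr_eq0.
have thN_root : (- theta^-1) ^+ 2 - n%:R * (- theta^-1) - 1 = 0.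
  by rewrite -[RHS](mulr0 (- (theta^-1) ^+ 2)) -th_root; field.
have n_gt0 : (0 < n)%N by apply: ltnW.
pose i1 : 'I_n.+1 := lift ord0 (Ordinal n_gt0).
pose i2 : 'I_n.+1 := lift ord0 (Ordinal n_gt1).
have i12 : i1 != i2 by [].
have lift_eig k (h : 'I_n.+1 -> F) b : Heigen k h -> (exists i, h i != 0) -> k * b = a ->
    eigenvalue (adjmx F e) b -> eigenvalue (adjmx F (@F2 n.+1 T e)) a.
  move=> Hh [i hi] <- /eigenvalue_adjmxP [f [ef [v fv]]]; apply/eigenvalue_adjmxP.
  exists (fun x => h x.1 * f x.2); split; first exact: eigenfun_F2_tensor.
  by exists (i, v); rewrite mulf_neq0.
have quot_neq0 k : exists i : 'I_n.+1, (if (0 < i)%N then 1 else 1 + k^-1) != 0 :> F.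
  by exists i1; rewrite oner_eq0.
split=> [/eigenvalue_adjmxP [g [eg [[j w] gw]]] | ]; last first.
  case.
  - apply: lift_eig (Heigen_difference (i1 := i1) (i2 := i2) isT isT) _ _;
      last by rewrite mulN1r opprK.
    by exists i1; rewrite eqxx (negPf i12) subr0 oner_eq0.
  - by apply: lift_eig (Heigen_quotient th_neq0 th_root) (quot_neq0 _) _; field.
  - by apply: lift_eig (Heigen_quotient thN_neq0 thN_root) (quot_neq0 _) _; field.
have [|noN] := boolP (eigenvalue (adjmx F e) (- a)); first by constructor 1.
have [|noth] := boolP (eigenvalue (adjmx F e) (a / theta)); first by constructor 2.
have [|noNth] := boolP (eigenvalue (adjmx F e) (- (theta * a))); first by constructor 3.
(* Otherwise all contractions of [g] against eigenvectors of [H] vanish. *)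
have vanish k (h : 'I_n.+1 -> F) v : k != 0 -> Heigen k h ->
    ~~ eigenvalue (adjmx F e) (a / k) -> \sum_i h i * g (i, v) = 0.
  move=> k_neq0 Hh; apply: contraNeq => gv; apply/eigenvalue_adjmxP.
  exists (fun u => \sum_i h i * g (i, u)); split; last by exists v.
  exact: eigenfun_F2_contract.
have g_const (i : 'I_n.+1) : (0 < i)%N -> g (i, w) = g (i1, w).
  move=> i_gt0; have := vanish _ _ w _ (Heigen_difference (i1 := i) (i2 := i1) i_gt0 isT) _.
  rewrite oppr_eq0 oner_eq0 invrN invr1 mulrN1 => /(_ isT noN) /eqP.
  under eq_bigr do rewrite mulrBl.
  have sum_delta (i0 : 'I_n.+1) : \sum_i (i == i0)%:R * g (i, w) = g (i0, w).
    by rewrite (bigD1 i0) //= eqxx mul1r big1 ?addr0 // => l /negPf ->; rewrite mul0r.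
  by rewrite sumrB !sum_delta subr_eq0 => /eqP.
have quot_eq k : k != 0 -> k ^+ 2 - n%:R * k - 1 = 0 ->
    ~~ eigenvalue (adjmx F e) (a / k) ->
    (1 + k^-1) * g (ord0, w) + n%:R * g (i1, w) = 0.
  move=> k_neq0 k_root no_k; have := vanish _ _ w k_neq0 (Heigen_quotient k_neq0 k_root) no_k.
  rewrite big_ord_recl /= (eq_bigr (fun=> g (i1, w))) => [|i _].
    by rewrite sumr_const card_ord mulr_natl.
  by rewrite mul1r g_const.
have eq1 := quot_eq _ th_neq0 th_root noth.
have eq2 : (1 - theta) * g (ord0, w) + n%:R * g (i1, w) = 0.
  have := quot_eq _ thN_neq0 thN_root; rewrite invrN invrK; apply.
  by rewrite mulrN [a * _]mulrC.
(* The vectors of [Heigen_quotient] for [theta] and [- theta^-1] are independent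
   because [theta ^+ 2 + 1] is nonzero. *)
have g0 : g (ord0, w) = 0.
  apply/(mulfI th2_neq); transitivity (theta *
      (((1 + theta^-1) * g (ord0, w) + n%:R * g (i1, w))
       - ((1 - theta) * g (ord0, w) + n%:R * g (i1, w)))); first by field.
  by rewrite eq1 eq2 subrr !mulr0.
have g1 : g (i1, w) = 0.
  by apply/(mulfI n_neq0); rewrite mulr0 -[RHS]eq1 g0 mulr0 add0r.
case/eqP: gw; have [j_gt0|] := ltnP 0 j; first by rewrite g_const.
by rewrite leqn0 => j0; rewrite (_ : j = ord0) //; apply/val_inj/eqP.
Qed.

End Shadow.

Lemma exists_root_gt1 (C : numClosedFieldType) n : (1 < n)%N ->
  exists2 theta : C, 1 < theta & theta ^+ 2 - n%:R * theta - 1 = 0.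
Proof.
move=> n_gt1; pose s : C := sqrtC (n%:R ^+ 2 + 4).
have s_gt0 : 0 < s by rewrite sqrtC_gt0 ltr_wpDl // exprn_ge0.
have s2 : s ^+ 2 = n%:R ^+ 2 + 4 by rewrite sqrtCK.
exists ((n%:R + s) / 2).
  rewrite ltr_pdivlMr // mul1r; apply: (le_lt_trans (y := n%:R)); first by rewrite ler_nat.
  by rewrite ltrDl.
have -> : ((n%:R + s) / 2) ^+ 2 - n%:R * ((n%:R + s) / 2) - 1 = (s ^+ 2 - n%:R ^+ 2 - 4) / 4.
  by field.
by rewrite s2; ring.
Qed.

Theorem theorem5p5 (C : numClosedFieldType) (T : finType) (e : rel T) (m : nat)
    (simple_e : simple_graph e) (conn_e : connected_graph e)
    (R_e : propertyR C e) (m_ge3 : (3 <= m)%N) :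
  propertyR C (@F2 m T e) <-> bipartite e.
Proof.
case: m m_ge3 => // n n_gt1; have [sym_e _] := simple_e.
have [/nonsingular_eigenvalue0 no0 inv_e] := R_e.
have [theta th_gt1 th_root] := exists_root_gt1 C n_gt1.
have th_gt0 : 0 < theta := lt_trans ltr01 th_gt1.
have th_neq0 : theta != 0 by rewrite gt_eqF.
have n_neq0 : n%:R != 0 :> C by rewrite pnatr_eq0 -lt0n ltnW.
have th2_neq : theta ^+ 2 + 1 != 0 by rewrite gt_eqF // addr_gt0 ?exprn_gt0.
have F2_spec a := eigenvalue_F2 e a n_gt1 n_neq0 th_neq0 th_root th2_neq.
split=> [[_ inv_F2] | bip_e]; last first.
  have oppE := bipartite_eigenvalueN (C := C) bip_e.
  split=> [|a /F2_spec eig_a]; last first.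
    apply/F2_spec; case: eig_a => /inv_e.
    - by rewrite invrN; constructor 1.
    - by rewrite invf_div => /oppE; constructor 3.
    - by rewrite invrN => /oppE; rewrite opprK invfM mulrC; constructor 2.
  apply/nonsingular_eigenvalue0/negP => /F2_spec.
  by rewrite mulr0 mul0r oppr0; case; apply/negP.
have T_gt0 := conn_e.1.
have [mu eig_mu mu_max] := exists_max_eigenvalue T_gt0 (adjmx_hermsym C sym_e).
have mu_neq0 : mu != 0 by apply: contraNneq no0 => <-.
have norm_le1 k : eigenvalue (adjmx C e) (k * mu) -> `|k| <= 1.
  by move=> /mu_max; rewrite normrM ger_pMl ?normr_gt0.
have norm_th : `|theta| = theta by rewrite gtr0_norm.
(* An eigenvalue of [F2] of maximal modulus: its inverse is too small for the
   families of [-1] and [theta]. *)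
have : eigenvalue (adjmx C (@F2 n.+1 T e)) (theta * mu).
  by apply/F2_spec; constructor 2; rewrite mulrAC divff // mul1r.
move=> /inv_F2 /F2_spec [] /inv_e.
- rewrite invrN invrK -mulNr => /norm_le1; rewrite normrN norm_th.
  by rewrite lt_geF.
- rewrite invf_div invrK mulrA => /norm_le1; rewrite normrM norm_th.
  by rewrite lt_geF ?mulr_egt1.
- rewrite invrN invfM invrK mulrA mulVf // mul1r => eig_Nmu.
  exact: (@perron_bipartite C T e mu).
Qed.
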